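(* Let $\Omega\subset\mathbb{R}^2$ be a bounded regular domain, and let $f\in L^\infty(\Omega)$ be such that $\|f\|_{L^\infty(\Omega)}\le\frac{C}{\varepsilon}$ for some $0<\varepsilon<1$ and some constant $C>0$. Then $$\|f\|_{L^{2,\infty}(\Omega)}^2\ \ge\ \frac{1}{2|\log\varepsilon|}\int_\Omega|f|^2-\frac{C^2|\Omega|}{2|\log\varepsilon|}.$$
   Context: $\|f\|_{L^{2,\infty}(\Omega)}=\sup_{E\subset\Omega,\,0<|E|<\infty}|E|^{-1/2}\int_E|f(x)|\,dx$, where $|E|$ is Lebesgue measure. *)

(* Defs.v *)
From HB Require Import structures.
From mathcomp Require Import all_boot all_order all_algebra.
From mathcomp Require Import all_classical all_reals all_analysis.

Set Implicit Arguments.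
Unset Strict Implicit.
Unset Printing Implicit Defensive.

Import Order.TTheory GRing.Theory Num.Theory.
Import numFieldNormedType.Exports.

Local Open Scope classical_set_scope.
Local Open Scope ring_scope.

(* The product measure of the library lives on the Borel sets of the plane.
   Its completion is Lebesgue measure on the Lebesgue-measurable sets, which
   are the Caratheodory-measurable sets of the induced outer measure.  The
   carrier of [plane R] is convertible to [R * R], so that a subset of [R * R]
   can be viewed as a subset of [plane R]. *)
Definition borel_lebesgue2 (R : realType) :
    {measure set (measurableTypeR R * measurableTypeR R) -> \bar R} :=
  (@lebesgue_measure R \x @lebesgue_measure R)%E.

Notation plane R := (caratheodory_type (mu_ext (borel_lebesgue2 R))).

Definition lebesgue2 (R : realType) : {measure set (plane R) -> \bar R} :=
  @completed_measure_extension _ _ R (borel_lebesgue2 R).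

Definition is_C1 (R : realType) (g : R -> R) : Prop :=
  (forall t, derivable g t 1) /\ continuous (derive1 g).

(* Near each boundary point, and in suitable orthonormal coordinates
   [u = a x1 + b x2], [v = - b x1 + a x2], the domain is the region above
   the graph of a C^1 function. *)
Definition C1_boundary (R : realType) (Omega : set (R * R)) : Prop :=
  forall p, (closure Omega `\` interior Omega) p ->
  exists (a b : R) (g : R -> R),
    [/\ a ^+ 2 + b ^+ 2 = 1, is_C1 g &
        \forall x \near p,
          Omega x <-> g (a * x.1 + b * x.2) < - b * x.1 + a * x.2].

Record bounded_regular_domain (R : realType) (Omega : set (R * R)) : Prop := {
  domain_nonempty : Omega !=set0 ;
  domain_open : open Omega ;
  domain_connected : connected Omega ;
  domain_bounded : bounded_set Omega ;
  domain_regular : C1_boundary Omega }.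

(* A function on [Omega] is given by a function on the whole plane; its values
   outside [Omega] are irrelevant ([\_] extends by zero). *)
Definition Linfty_norm (R : realType) (Omega : set (plane R))
    (f : plane R -> R) : \bar R :=
  ('N[lebesgue2 R]_+oo [(EFin \o f) \_ Omega])%E.

Definition in_Linfty (R : realType) (Omega : set (plane R))
    (f : plane R -> R) : Prop :=
  measurable_fun Omega f /\ (Linfty_norm Omega f < +oo)%E.

Definition weakL2_norm (R : realType) (Omega : set (plane R))
    (f : plane R -> R) : \bar R :=
  ereal_sup [set ((fine (lebesgue2 R E) `^ (- 2^-1))%:E
                   * \int[lebesgue2 R]_(x in E) `|f x|%:E)%E
            | E in [set E : set (plane R) |
                [/\ measurable E, E `<=` Omega &
                    (0 < lebesgue2 R E < +oo)%E]]].

(* Main.v *)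
Require Import Defs.
From HB Require Import structures.
From mathcomp Require Import all_boot all_order all_algebra.
From mathcomp Require Import all_classical all_reals all_analysis.
From mathcomp Require Import measurable_realfun ess_sup_inf ring lra.

Set Implicit Arguments.
Unset Strict Implicit.
Unset Printing Implicit Defensive.

Import Order.TTheory GRing.Theory Num.Theory.
Import numFieldNormedType.Exports.

Local Open Scope classical_set_scope.
Local Open Scope ring_scope.

(** Write [N] for the weak L^2 norm of [f] and [L] for the logarithm of
[1 / eps].  Testing the supremum that defines [N] on a superlevel set
[E_t = {|f| > t}] gives [t |E_t| <= \int_(E_t) |f| <= N |E_t|^(1/2)], that is
[t^2 |E_t| <= N^2] ([superlevel_le_weakL2]).  The layer cake formula then gives
the result: below the level [C] bound [|E_t|] by [|Omega|], and between [C] and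
[C / eps] use [t^2 |E_t| <= N^2], so that
[\int |f|^2 = \int 2 t |E_t| dt <= C^2 |Omega| + 2 N^2 \int dt / t
= C^2 |Omega| + 2 L N^2].

The layer cake formula is used here in a discrete form, which needs neither
Fubini's theorem nor an integral in [t].  Cut [[C, C / eps]] at the levels
[t_k = C q^k], where [q^n = 1 / eps].  Pointwise, [f^2] is at most [C^2] plus the
sum of the jumps [t_(k+1)^2 - t_k^2 = (q^2 - 1) t_k^2] over the levels below
[|f|] ([sqr_le_levels]); as the levels are in geometric progression, each layer
contributes at most [(q^2 - 1) N^2] to the integral, whatever [k]
([integral_sqr_le_levels]).  The total [n (q^2 - 1) N^2], with [q = exp (L / n)],
tends to [2 L N^2] as [n] grows ([integral_sqr_le_weak]).

There remains to see that [Omega], being open, is Lebesgue measurable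
([open_plane_measurable]): the product sigma-algebra is generated by rectangles,
and an open set is a countable union of rational squares. *)

(** * The discrete layer cake inequality *)

(** Induction on [n] for the truncation of [y] at the level [c q^n]: raising the
truncation to the next level changes its square only if [y] exceeds [c q^n], and
then by at most [(q^2 - 1) (c q^n)^2]. *)
Lemma sqr_le_levels (R : realType) (c q y : R) (n : nat) :
  0 <= c -> 1 <= q -> 0 <= y -> y <= c * q ^+ n ->
  y ^+ 2 <= c ^+ 2 + \sum_(k < n)
    (q ^+ 2 - 1) * (c * q ^+ k) ^+ 2 * (c * q ^+ k < y)%R%:R.
Proof.
move=> c0 q1 y0; have q0 : 0 <= q by exact: le_trans q1.
have q21 : 0 <= q ^+ 2 - 1 by rewrite subr_ge0 expr_ge1.
suff H : Num.min y (c * q ^+ n) ^+ 2 <= c ^+ 2 + \sum_(k < n)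
    (q ^+ 2 - 1) * (c * q ^+ k) ^+ 2 * (c * q ^+ k < y)%R%:R.
  by move=> yn; move: H; rewrite min_l.
elim: n => [|n IHn].
  rewrite big_ord0 addr0 expr0 mulr1 ler_pXn2r ?nnegrE ?le_min ?y0//.
  by rewrite ge_min lexx orbT.
rewrite big_ord_recr/= addrA; have [yn|ny] := ltP (c * q ^+ n) y.
- rewrite mulr1; move: IHn; rewrite min_r; last exact: ltW.
  move=> IHn; apply: le_trans (lerD IHn (lexx _)).
  rewrite -{1}[(c * q ^+ n) ^+ 2]mul1r -mulrDl subrKC -exprMn.
  rewrite mulrCA -exprS ler_pXn2r ?nnegrE ?le_min ?y0 ?mulr_ge0 ?exprn_ge0//.
  by rewrite ge_min lexx orbT.
- rewrite mulr0 addr0; move: IHn; rewrite min_l// => IHn.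
  by rewrite min_l// (le_trans ny)// ler_wpM2l// ler_weXn2l.
Qed.

(** A quantitative form of [expR x - 1 ~ x] near 0, with which the limit in the
number of levels is taken; it follows from [1 - x <= expR (- x)]. *)
Lemma expR_sub1_le (R : realType) (x : R) : 0 <= x <= 2^-1 ->
  expR x - 1 <= x + 2 * x ^+ 2.
Proof.
move=> /andP[x0 x2].
have e1 := expR_ge1Dx (- x).
have e0 := expR_gt0 x.
have : expR x * (1 - x) <= 1.
  by rewrite -[leRHS](expRxMexpNx_1 x) ler_wpM2l// ltW.
nra.
Qed.

Section layers.
Context d (T : measurableType d) (R : realType).
Variables (mu : {measure set T -> \bar R}) (D : set T) (f : T -> R).
Hypotheses (mD : measurable D) (mf : measurable_fun D f).

Let superlevel (t : R) := D `&` [set x | t < `|f x|].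

Lemma measurable_superlevel t : measurable (superlevel t).
Proof.
have mnf : measurable_fun D (fun x => `|f x|) by exact: measurableT_comp.
rewrite (_ : superlevel t = D `&` (fun x => `|f x|) @^-1` `]t, +oo[%classic).
  by apply: mnf => //; exact: measurable_itv.
by apply/seteqP; split=> x [Dx] /=; rewrite in_itv/= andbT.
Qed.

(** The hypothesis on [t ^+ 2 * mu {|f| > t}] bounds all the layers by the same
quantity, because the jump of the square at the level [t = c q^k] is a fixed
multiple of [t ^+ 2]. *)
Lemma integral_sqr_le_levels (c q B : R) (n : nat) :
  0 <= c -> 1 <= q ->
  (\forall x \ae mu, D x -> `|f x| <= c * q ^+ n) ->
  (forall t, c <= t -> ((t ^+ 2)%:E * mu (superlevel t) <= B%:E)%E) ->
  (\int[mu]_(x in D) (`|f x| ^+ 2)%:E <=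
     (c ^+ 2)%:E * mu D + (n%:R * (q ^+ 2 - 1) * B)%:E)%E.
Proof.
move=> c0 q1 fn weak; have q0 : 0 <= q by exact: le_trans q1.
have q21 : 0 <= q ^+ 2 - 1 by rewrite subr_ge0 expr_ge1.
pose a k := (q ^+ 2 - 1) * (c * q ^+ k) ^+ 2.
have a0 k : 0 <= a k by rewrite mulr_ge0 ?exprn_ge0 ?mulr_ge0 ?exprn_ge0.
(* the k-th layer: the jump of the square times the indicator of its level *)
pose g (k : 'I_n) (x : T) : \bar R :=
  ((a k)%:E * (\1_(superlevel (c * q ^+ k)) x)%:E)%E.
have g0 k x : D x -> (0 <= g k x)%E.
  by move=> _; rewrite /g -EFinM lee_fin mulr_ge0.
have mg k : measurable_fun D (g k).
  apply/measurable_EFinP; apply: measurable_funM => //.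
  apply: measurable_indic.
  exact: measurable_superlevel.
have sg0 x : D x -> (0 <= \sum_(k < n) g k x)%E.
  by move=> Dx; apply: sume_ge0 => k _; exact: g0.
have msg : measurable_fun D (fun x => (\sum_(k < n) g k x)%E).
  exact: emeasurable_sum.
apply: (@le_trans _ _
    (\int[mu]_(x in D) ((c ^+ 2)%:E + \sum_(k < n) g k x))%E).
  apply: ae_ge0_le_integral => //.
  - by apply/measurable_EFinP; apply: measurable_funX; exact: measurableT_comp.
  - by move=> x Dx; rewrite adde_ge0 ?sg0// lee_fin exprn_ge0.
  - exact: emeasurable_funD.
  - apply: filterS fn => x fx Dx.
    rewrite [leRHS](_ : _ = (c ^+ 2 + \sum_(k < n)
        a k * (c * q ^+ k < `|f x|)%R%:R)%:E).
      by rewrite lee_fin sqr_le_levels ?fx.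
    rewrite EFinD -sumEFin; congr (_ + _)%E; apply: eq_bigr => k _.
    rewrite /g EFinM indicE /superlevel; congr (_ * (_ %:R)%:E)%E.
    congr nat_of_bool; apply/idP/idP => [|H]; first by rewrite inE => -[].
    by rewrite inE; split.
rewrite ge0_integralD//; last by move=> x _; rewrite lee_fin exprn_ge0.
rewrite integral_cst// leeD2l// ge0_integral_sum//.
apply: (@le_trans _ _ (\sum_(k < n) ((q ^+ 2 - 1) * B)%:E)%E).
  apply: lee_sum => k _; rewrite ge0_integralZl_EFin//; last first.
    apply/measurable_EFinP; apply: measurable_indic.
    exact: measurable_superlevel.
  rewrite integral_indic//; last exact: measurable_superlevel.
  rewrite (_ : _ `&` D = superlevel (c * q ^+ k)); last first.
    by apply/setIidl => x [].
  rewrite /a !EFinM -muleA; apply: lee_wpmul2l; first by rewrite lee_fin.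
  by apply: weak; rewrite ler_peMr// exprn_ege1.
by rewrite sumEFin sumr_const card_ord -mulrA mulr_natl.
Qed.

(** For bounded functions a weak L^2 bound gives an L^2 bound, up to a logarithm:
[2 * ln (M / c) * B] is the integral of [2 t * (B / t^2)] over [[c, M]].  It is
reached as the limit of the bounds of [integral_sqr_le_levels] for finer and
finer geometric progressions from [c] to [M]. *)
Lemma integral_sqr_le_weak (c M B : R) :
  0 < c -> c <= M -> 0 <= B ->
  (\forall x \ae mu, D x -> `|f x| <= M) ->
  (forall t, c <= t -> ((t ^+ 2)%:E * mu (superlevel t) <= B%:E)%E) ->
  (\int[mu]_(x in D) (`|f x| ^+ 2)%:E <=
     (c ^+ 2)%:E * mu D + (2 * ln (M / c) * B)%:E)%E.
Proof.
move=> c0 cM B0 fM weak; set l := ln (M / c).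
have Mc1 : 1 <= M / c by rewrite ler_pdivlMr// mul1r.
have l0 : 0 <= l by rewrite ln_ge0.
apply/lee_addgt0Pr => e e0.
(* the first term makes [2 l / n.+1 <= 1/2], the second makes the second-order
   error of the exponential, [8 l^2 B / n.+1], at most [e] *)
have [n nl] : exists n : nat, 4 * l + 8 * l ^+ 2 * B / e < n.+1%:R.
  exists (Num.truncn (4 * l + 8 * l ^+ 2 * B / e)).
  by rewrite truncnS_gt.
pose q := expR (l / n.+1%:R).
have n0 : 0 < n.+1%:R :> R by rewrite ltr0n.
have qn : c * q ^+ n.+1 = M.
  rewrite -expRM_natl mulrCA divff ?gt_eqF// mulr1 lnK ?posrE.
    by rewrite mulrCA divff ?gt_eqF// mulr1.
  by rewrite (lt_le_trans ltr01).
have q1 : 1 <= q by rewrite -expR0 ler_expR divr_ge0.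
have le1 := @integral_sqr_le_levels c q B n.+1 (ltW c0) q1.
rewrite qn in le1; apply: (le_trans (le1 fM weak)).
rewrite -addeA leeD2l// -EFinD lee_fin.
have eB : 0 <= 8 * l ^+ 2 * B / e.
  by rewrite divr_ge0 ?mulr_ge0 ?exprn_ge0// ltW.
have x2 : 0 <= 2 * l / n.+1%:R <= 2^-1.
  rewrite divr_ge0 ?mulr_ge0//= ler_pdivrMr//; lra.
have := expR_sub1_le x2.
rewrite -[expR _](_ : q ^+ 2 = _); last first.
  by rewrite -expRM_natl mulrA.
move=> qx.
have -> : 2 * l * B + e =
   n.+1%:R * ((2 * l / n.+1%:R) + 2 * (2 * l / n.+1%:R) ^+ 2) * B +
   (e - 8 * l ^+ 2 * B / n.+1%:R).
  by field; rewrite gt_eqF.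
rewrite -[leLHS]addr0 lerD//; first by rewrite ler_wpM2r// ler_wpM2l// ltW.
rewrite subr_ge0 ler_pdivrMr// [e * _]mulrC -ler_pdivrMr//.
lra.
Qed.

End layers.

(** * Lebesgue measurability of open sets in the plane *)

Section open_plane.
Variable R : realType.

Lemma rat_approx (x e : R) : 0 < e -> exists q : rat, `|x - ratr q| < e.
Proof.
move=> e0; have [|q] := @rat_in_itvoo R (x - e) (x + e).
  by rewrite ltrD2l gtrN.
rewrite in_itv/= => /andP[qa qb]; exists q.
by rewrite distrC ltr_distl qa qb.
Qed.

(** Balls for the product distance are squares, hence measurable rectangles, and
an open set is the union of the countably many balls with rational center and
radius that it contains. *)
Lemma open_measurable_prod (A : set (R * R)) : open A ->
  measurable (A : set (measurableTypeR R * measurableTypeR R)).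
Proof.
move=> oA.
have mb (p : R * R) e : measurable
    (ball p e : set (measurableTypeR R * measurableTypeR R)).
  have -> : ball p e = ball p.1 e `*` ball p.2 e :> set (R * R).
    by apply/seteqP; split.
  by apply: measurableX; exact: measurable_ball.
pose I := [set i : rat * rat * rat |
  ball ((ratr i.1.1, ratr i.1.2) : R * R) (ratr i.2) `<=` A].
have -> : A = \bigcup_(i in I)
    ball ((ratr i.1.1, ratr i.1.2) : R * R) (ratr i.2).
  apply/seteqP; split=> [x Ax|x [i]]; last by move=> /[apply].
  have [e /= e0 xeA] : exists2 e : R, 0 < e & ball x e `<=` A.
    by apply/nbhs_ballP; exact: open_nbhs_nbhs.
  (* half of the radius: a ball of radius [r] that contains [x] lies in the ball
     of center [x] and radius [2 r] *)
  have [|r /=] := @rat_in_itvoo R 0 (e / 2); first exact: divr_gt0.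
  rewrite in_itv/= => /andP[r0 re].
  have [q1 xq1] := rat_approx x.1 r0.
  have [q2 xq2] := rat_approx x.2 r0.
  have xq : ball ((ratr q1, ratr q2) : R * R) (ratr r) x.
    by split; rewrite /= /ball/= distrC.
  exists (q1, q2, r) => //= y qy; apply: xeA.
  apply: (@le_ball _ _ _ (ratr r + ratr r)).
    by rewrite (splitr e) lerD// ltW.
  exact: ball_triangle (ball_sym xq) qy.
rewrite bigcup_mkcond; apply: countable_bigcupT_measurable => // i.
by case: ifP.
Qed.
End open_plane.

(** * The weak norm and the superlevel sets *)

Section plane.
Variable R : realType.
Implicit Types (Omega : set (plane R)) (f : plane R -> R).

Lemma open_plane_measurable (A : set (R * R)) :
  open A -> measurable (A : set (plane R)).
Proof.
move=> /open_measurable_prod mA; apply: sub_caratheodory.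
exact: sub_sigma_algebra.
Qed.

Lemma Linfty_norm_le_ae Omega f (M : R) : (Linfty_norm Omega f <= M%:E)%E ->
  \forall x \ae lebesgue2 R, Omega x -> `|f x| <= M.
Proof.
rewrite /Linfty_norm unlock; case: ifPn => [_ /ess_supP|mu0 _].
  apply: filterS => x /=; rewrite patchE => + Ox.
  by rewrite mem_set//= lee_fin.
(* the norm is 0 by convention when the measure is zero; every property then
   holds almost everywhere *)
exists setT; split => //.
by apply/eqP; rewrite eq_le measure_ge0 leNgt mu0.
Qed.

(** Chebyshev's inequality for the weak norm: unless it is negligible, the
superlevel set [E] of level [t] is one of the test sets of the supremum, and
[\int_E |f| >= t |E|]. *)
Lemma superlevel_le_weakL2 Omega f (N t : R) :
  measurable Omega -> measurable_fun Omega f ->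
  (lebesgue2 R Omega < +oo)%E -> weakL2_norm Omega f = N%:E -> 0 < t ->
  ((t ^+ 2)%:E * lebesgue2 R (Omega `&` [set x | (t < `|f x|)%R]) <=
     (N ^+ 2)%:E)%E.
Proof.
move=> mO mf Ofin fN t0; set E := Omega `&` _.
have mE : measurable E by exact: measurable_superlevel.
have [E0|E0] := eqVneq (lebesgue2 R E) 0%E.
  by rewrite E0 mule0 lee_fin sqr_ge0.
have Ele : (lebesgue2 R E <= lebesgue2 R Omega)%E.
  by apply: le_measure; rewrite ?inE//; exact: subIsetl.
have Efin : lebesgue2 R E \is a fin_num.
  by rewrite ge0_fin_numE// (le_lt_trans Ele).
have Egt0 : (0 < lebesgue2 R E)%E by rewrite lt0e E0 measure_ge0.
have m0 : 0 < fine (lebesgue2 R E) by rewrite fine_gt0// Egt0 (le_lt_trans Ele).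
have : ((fine (lebesgue2 R E) `^ (- 2^-1))%:E
    * \int[lebesgue2 R]_(x in E) `|f x|%:E <= N%:E)%E.
  rewrite -fN; apply: ereal_sup_ubound; exists E => //.
  by split; [|exact: subIsetl|rewrite Egt0 (le_lt_trans Ele)].
have tE : (t%:E * lebesgue2 R E <= \int[lebesgue2 R]_(x in E) `|f x|%:E)%E.
  rewrite -integral_cst//; apply: ge0_le_integral => //.
  - by move=> x _; rewrite lee_fin ltW.
  - apply/measurable_EFinP; apply: measurableT_comp => //.
    by apply: measurable_funS mf => //; exact: subIsetl.
  - by move=> x [_ /ltW]; rewrite lee_fin.
move=> /(le_trans (lee_wpmul2l _ tE)); rewrite lee_fin powR_ge0 => /(_ isT).
rewrite -(fineK Efin) -!EFinM !lee_fin /=.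
set m := fine _ in m0 *.
set s := m `^ (- 2^-1) => sN.
have s2m : s ^+ 2 * m = 1.
  rewrite -powR_mulrn ?powR_ge0// -powRrM mulNr mulVf ?pnatr_eq0//.
  by rewrite powR_inv1 ?ltW// mulVf// gt_eqF.
have -> : t ^+ 2 * m = (s * (t * m)) ^+ 2.
  by rewrite !exprMn mulrCA [m ^+ 2]expr2 [s ^+ 2 * _]mulrA s2m mul1r.
have stm0 : 0 <= s * (t * m) by rewrite !mulr_ge0 ?powR_ge0// ltW.
by rewrite ler_pXn2r// nnegrE// (le_trans stm0).
Qed.

End plane.

Theorem proposition1p4 (R : realType) (Omega : set (R * R))
    (f : R * R -> R) (C eps : R) :
  bounded_regular_domain Omega ->
  0 < C -> 0 < eps < 1 ->
  in_Linfty Omega f ->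
  (Linfty_norm Omega f <= (C / eps)%:E)%E ->
  (weakL2_norm Omega f ^+ 2 >=
     ((2 * `|ln eps|)^-1)%:E
       * \int[lebesgue2 R]_(x in Omega) (`|f x| ^+ 2)%:E
     - (C ^+ 2 / (2 * `|ln eps|))%:E * lebesgue2 R Omega)%E.
Proof.
move=> Oreg C0 /andP[eps0 eps1] [mf _] fM.
have mO := open_plane_measurable (domain_open Oreg).
have lneps : ln eps < 0 by rewrite ln_lt0// eps0.
set l := `|ln eps|; have l0 : 0 < l by rewrite normr_gt0 lt_eqF.
(* if [|Omega| = +oo], then the right-hand side is [-oo], also when the integral
   of [|f|^2] is infinite, since [+oo - +oo = -oo] *)
have [Ooo|Ofin] := eqVneq (lebesgue2 R Omega) +oo%E.
  rewrite Ooo gt0_muley ?lte_fin ?divr_gt0 ?mulr_gt0 ?exprn_gt0//.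
  by rewrite addeNy leNye.
have {}Ofin : (lebesgue2 R Omega < +oo)%E by rewrite ltey.
(* only a finite weak norm matters: both infinite values have the square +oo *)
case: (weakL2_norm Omega f) (@superlevel_le_weakL2 _ Omega f) => [N||] weak;
  [|by rewrite leey|by rewrite leey].
have := @integral_sqr_le_weak _ _ _ (lebesgue2 R) Omega f mO mf C (C / eps)
  (N ^+ 2) C0.
have -> : ln (C / eps / C) = l.
  by rewrite mulrAC divff ?gt_eqF// mul1r lnV ?posrE// /l ltr0_norm.
have CM : C <= C / eps by rewrite ler_pdivlMr// ler_piMr// ltW.
move=> /(_ CM (sqr_ge0 _) (Linfty_norm_le_ae fM)) weak2.
have {weak2} : (\int[lebesgue2 R]_(x in Omega) (`|f x| ^+ 2)%:E <=
    (C ^+ 2)%:E * lebesgue2 R Omega + (2 * l * N ^+ 2)%:E)%E.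
  by apply: weak2 => t Ct; apply: weak => //; exact: lt_le_trans Ct.
set I := integral _ _ _.
have I0 : (0 <= I)%E by apply: integral_ge0 => x _; rewrite lee_fin sqr_ge0.
rewrite -[lebesgue2 R Omega]fineK ?ge0_fin_numE//; set m := fine _.
rewrite -EFinM -EFinD => IN.
have If : I \is a fin_num by rewrite ge0_fin_numE// (le_lt_trans IN) ?ltry.
rewrite -(fineK If) lee_fin in IN *.
rewrite -!EFinM -EFinB lee_fin.
have l20 : 0 < 2 * l by rewrite mulr_gt0.
rewrite [leLHS](_ : _ = (fine I - C ^+ 2 * m) / (2 * l)); last first.
  by field; rewrite gt_eqF.
by rewrite ler_pdivrMr// lerBlDl -expr2 [N ^+ 2 * _]mulrC.
Qed.
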